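(* Let $(X_e)_{e\in E}$ be a finite family of mutually independent events with probabilities $p_e=P(X_e)$, and let $S_1,S_2\subseteq E$. For $i=1,2$ say that proof $i$ is available when all events $X_e$ with $e\in S_i$ occur, so that proof $i$ is available with probability $c_i=\prod_{e\in S_i}p_e$. Let $s=\prod_{e\in S_1\cap S_2}p_e$ be the product over the shared events (with $s=1$ if $S_1\cap S_2=\emptyset$). Then the probability that both proofs are available is $c_1c_2/s$, and the probability that at least one of the two proofs is available is $$c_1+c_2-\frac{c_1c_2}{s}.$$ Moreover $c_1\le s$ and $c_2\le s$; if $S_1$ and $S_2$ are disjoint, the probability that at least one proof is available is $c_1+c_2-c_1c_2$; and if one of the sets $S_1,S_2$ contains the other, it is $\max(c_1,c_2)$.
   Context: The index set $E$ represents uncertain premises (activation events); the event $X_e$ means that premise $e$ is active, and $S_i$ is the set of uncertain premises used by proof $i$. The two proofs are proofs of the same answer. Empty products equal $1$. The quotient $c_1c_2/s$ is read where it is defined, that is, when $s\neq 0$; no restriction is placed on the probabilities of non-shared premises. *)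

(* Defs.v *)
From HB Require Import structures.
From mathcomp Require Import all_boot all_order all_algebra.
From mathcomp Require Import all_classical all_reals all_analysis.

Set Implicit Arguments.
Unset Strict Implicit.
Unset Printing Implicit Defensive.

Import Order.TTheory GRing.Theory Num.Theory.

Local Open Scope classical_set_scope.
Local Open Scope ring_scope.

(* The product rule is required for every finite subfamily, not only for
   pairs.  Events are indexed, so two indices may carry the same set. *)
Definition mutually_independent (d : measure_display) (T : measurableType d)
    (R : realType) (P : probability T R) (E : finType) (X : E -> set T) : Prop :=
  (forall e, measurable (X e)) /\
  forall J : {set E},
    P (\bigcap_(e in [set` J]) X e) = (\prod_(e in J) P (X e))%E.

(* The event that a proof with premise set S is available; it is the sure
   event when S is empty. *)
Definition available (T : Type) (E : finType) (X : E -> set T)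
    (S : {set E}) : set T :=
  \bigcap_(e in [set` S]) X e.

(* Main.v *)
Require Import Defs.
From mathcomp Require Import all_boot all_order all_algebra.
From mathcomp Require Import all_classical all_reals all_analysis.

Set Implicit Arguments.
Unset Strict Implicit.
Unset Printing Implicit Defensive.

Import Order.TTheory GRing.Theory Num.Theory.

Local Open Scope ring_scope.

(** Both proofs are available exactly when every premise of [S1 :|: S2] is active, so independence
    gives the joint event the product [u] of [p] over the union. A shared premise counts once in [u]
    but twice in [c1 * c2], whence [u * s = c1 * c2] ([prodr_setUI]). Inclusion-exclusion
    ([probability_available_or]) then gives [c1 + c2 - u]. Only the formulas with the quotient
    divide by [s]; the disjoint and nested cases are read off from [u] and hold even when [s]
    vanishes. *)

(** The union splits into [A] and [B :\: A], and the factors over [B :\: A] and [A :&: B] recombine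
    into the product over [B]. No division occurs, so zero factors are harmless. *)
Lemma prodr_setUI (R : comPzSemiRingType) (E : finType) (p : E -> R)
    (A B : {set E}) :
  (\prod_(e in A :|: B) p e) * (\prod_(e in A :&: B) p e) =
  (\prod_(e in A) p e) * (\prod_(e in B) p e).
Proof.
rewrite (big_setID A) finset.setUK finset.setDUl finset.setDv finset.set0U -mulrA; congr (_ * _).
by rewrite [RHS](big_setID A) finset.setIC mulrC.
Qed.

(** The extra factors, over [B :\: A], multiply to at most 1. This serves both the bounds by [s] and
    the nested case. *)
Lemma ler_prod_subset (R : numDomainType) (E : finType) (p : E -> R)
    (A B : {set E}) :
  (forall e, 0 <= p e <= 1) -> A \subset B ->
  \prod_(e in B) p e <= \prod_(e in A) p e.
Proof.
move=> p01 /finset.setIidPr AB; rewrite (big_setID A) AB ler_piMr //.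
  by apply: prodr_ge0 => e _; case/andP: (p01 e).
by apply: Num.Theory.prodr_ile1 => e _; exact: p01.
Qed.

Lemma available_setU (T : Type) (E : finType) (X : E -> set T)
    (A B : {set E}) :
  available X (A :|: B) = (available X A `&` available X B)%classic.
Proof.
rewrite /available -bigcap_setU; congr bigcap.
by apply/seteqP; split => e /=; rewrite inE => /orP.
Qed.

Lemma measurable_available (d : measure_display) (T : measurableType d)
    (E : finType) (X : E -> set T) (A : {set E}) :
  (forall e, measurable (X e)) -> measurable (available X A).
Proof.
by move=> mX; apply: fin_bigcap_measurable => // e _; exact: mX.
Qed.

Lemma probability_available (d : measure_display) (T : measurableType d)
    (R : realType) (P : probability T R) (E : finType) (X : E -> set T)
    (p : E -> R) (A : {set E}) :
  mutually_independent P X -> (forall e, P (X e) = (p e)%:E) ->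
  P (available X A) = (\prod_(e in A) p e)%:E.
Proof.
move=> [_ indepX] pE; rewrite /available indepX -prodEFin.
by apply: eq_bigr => e _; rewrite pE.
Qed.

Lemma probability_available_or (d : measure_display) (T : measurableType d)
    (R : realType) (P : probability T R) (E : finType) (X : E -> set T)
    (p : E -> R) (A B : {set E}) :
  mutually_independent P X -> (forall e, P (X e) = (p e)%:E) ->
  P (available X A `|` available X B)%classic =
  (\prod_(e in A) p e + \prod_(e in B) p e - \prod_(e in A :|: B) p e)%:E.
Proof.
move=> indepX pE; have [mX _] := indepX.
have PA S := probability_available S indepX pE.
(* Inclusion-exclusion subtracts in the extended reals, so [measureUfinl] asks for a finite
   measure. *)
have PAoo : (P (available X A) < +oo)%E by rewrite PA ltry.
have mA S : measurable (available X S) by exact: measurable_available.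
transitivity (P (available X A) + P (available X B)
              - P (available X A `&` available X B)%classic)%E.
  exact: measureUfinl.
by rewrite -available_setU !PA.
Qed.

Theorem mainTheorem3 (d : measure_display) (T : measurableType d) (R : realType)
    (P : probability T R) (E : finType) (X : E -> set T) (p : E -> R)
    (S1 S2 : {set E})
    (indepX : mutually_independent P X)
    (pE : forall e, P (X e) = (p e)%:E) :
  let A1 := available X S1 in
  let A2 := available X S2 in
  let c1 := \prod_(e in S1) p e in
  let c2 := \prod_(e in S2) p e in
  let s := \prod_(e in S1 :&: S2) p e in
  (P A1 = c1%:E /\ P A2 = c2%:E) /\
  (s != 0 ->
    P (A1 `&` A2)%classic = (c1 * c2 / s)%:E /\
    P (A1 `|` A2)%classic = (c1 + c2 - c1 * c2 / s)%:E) /\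
  (c1 <= s /\ c2 <= s) /\
  ([disjoint S1 & S2] -> P (A1 `|` A2)%classic = (c1 + c2 - c1 * c2)%:E) /\
  ((S1 \subset S2) || (S2 \subset S1) ->
    P (A1 `|` A2)%classic = (Num.max c1 c2)%:E).
Proof.
move=> A1 A2 c1 c2 s.
have [mX _] := indepX.
(* The bounds on [p] come from [pE], its values being probabilities. *)
have p01 e : 0 <= p e <= 1.
  by rewrite -!lee_fin -pE measure_ge0 probability_le1.
have PA S : P (available X S) = (\prod_(e in S) p e)%:E.
  exact: probability_available.
have PU : P (A1 `|` A2)%classic = (c1 + c2 - \prod_(e in S1 :|: S2) p e)%:E.
  exact: probability_available_or.
have cUI : (\prod_(e in S1 :|: S2) p e) * s = c1 * c2 by exact: prodr_setUI.
split; first by rewrite !PA.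
split.
  move=> s0.
  have cU : \prod_(e in S1 :|: S2) p e = c1 * c2 / s by rewrite -cUI mulfK.
  by rewrite PU cU -available_setU PA cU.
split; first by split; apply: ler_prod_subset; rewrite ?finset.subsetIl ?finset.subsetIr.
split.
  (* Here [s] is an empty product, so [cUI] reads [u = c1 * c2]. *)
  move=> /disjoint_setI0 S12.
  by rewrite PU -cUI /s S12 big_set0 mulr1.
(* The union is the larger set, whose product cancels; what remains is the product over the smaller
   set, which is the maximum. *)
case/orP => S12; rewrite PU.
- by rewrite (finset.setUidPr S12) addrK max_l //; exact: ler_prod_subset.
- by rewrite (finset.setUidPl S12) addrC addKr max_r //; exact: ler_prod_subset.
Qed.
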